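(* Let $\boldsymbol\xi_1,\dots,\boldsymbol\xi_N\in\mathbb R^d$, $d_{ij}=\|\boldsymbol\xi_i-\boldsymbol\xi_j\|^2$, let $K\ge1$ be an integer with $n=N/K\in\mathbb N$, and let $n_k=n$ for $k=1,\dots,K$. Assume there exists a partition $(J_1,\dots,J_K)$ of $\{1,\dots,N\}$ with $|J_k|=N/K$ for all $k$ and $$\max_{1\le k\le K}\ \max_{i,j\in J_k}d_{ij}\ <\ \min_{1\le k_1<k_2\le K}\ \min_{i\in J_{k_1},\,j\in J_{k_2}}d_{ij}.$$ Then the optimal values of $\mathcal R^{\mathrm b}_{\mathrm{LP}}$ and $\mathcal P$ (defined in the context) coincide. Moreover, the clustering $(J_1,\dots,J_K)$ is optimal in $\mathcal P$, and it is recovered (up to relabeling of the clusters) by the rounding algorithm for balanced clustering described in the context.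
   Context: $\|\cdot\|$ is the Euclidean norm, $\langle\mathbf A,\mathbf B\rangle=\mathrm{Tr}(\mathbf A\mathbf B)$, $\mathbf 1$ is the all-ones vector, $\mathrm{diag}(\mathbf A)$ the vector of diagonal entries; $\succeq$ is the positive semidefinite order and $\ge,\le$ between matrices are elementwise. $\mathbb S^N$ is the set of symmetric $N\times N$ matrices and $\mathbf D=(d_{ij})\in\mathbb S^N$. A minimum over the empty set is $+\infty$. Problem $\mathcal P$ (cardinality-constrained $K$-means clustering): minimize $\frac12\sum_{k=1}^K\frac1{n_k}\sum_{i,j=1}^N d_{ij}\eta_{ij}^k$ over $\pi_i^k\in\{0,1\}$, $\eta_{ij}^k\in\mathbb R_+$ subject to $\sum_{i=1}^N\pi_i^k=n_k$ for all $k$, $\sum_{k=1}^K\pi_i^k=1$ for all $i$, and $\eta_{ij}^k\ge\pi_i^k+\pi_j^k-1$ for all $i,j,k$. A clustering $(I_1,\dots,I_K)$ corresponds to $\pi_i^k=1$ if $i\in I_k$, $\pi_i^k=0$ otherwise, and $\eta_{ij}^k=\max\{\pi_i^k+\pi_j^k-1,0\}$. For $n\in\mathbb N$, $\mathcal C_{\mathrm{SDP}}(n)$ is the set of all $(\boldsymbol x,\mathbf M)\in\mathbb R^N\times\mathbb S^N$ such that (i) $\mathbf 1^\top\boldsymbol x=2n-N$, $\mathbf M\mathbf 1=(2n-N)\boldsymbol x$, $\mathrm{diag}(\mathbf M)=\mathbf 1$; (ii) $\mathbf M\succeq\boldsymbol x\boldsymbol x^\top$; (iii) $\mathbf M+\mathbf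 1\mathbf 1^\top+\boldsymbol x\mathbf 1^\top+\mathbf 1\boldsymbol x^\top\ge\mathbf 0$, $\mathbf M+\mathbf 1\mathbf 1^\top-\boldsymbol x\mathbf 1^\top-\mathbf 1\boldsymbol x^\top\ge\mathbf 0$, $\mathbf M-\mathbf 1\mathbf 1^\top+\boldsymbol x\mathbf 1^\top-\mathbf 1\boldsymbol x^\top\le\mathbf 0$, $\mathbf M-\mathbf 1\mathbf 1^\top-\boldsymbol x\mathbf 1^\top+\mathbf 1\boldsymbol x^\top\le\mathbf 0$. $\mathcal C_{\mathrm{LP}}(n)$ is defined by (i) and (iii) only. Problem $\mathcal R^{\mathrm b}_{\mathrm{SDP}}$ (for $N$ datapoints and $K=N/n$ clusters): minimize $$\tfrac1{8n}\big\langle\mathbf D,\ \mathbf M^1+\mathbf 1\mathbf 1^\top+\boldsymbol x^1\mathbf 1^\top+\mathbf 1(\boldsymbol x^1)^\top+(K-1)(\mathbf M+\mathbf 1\mathbf 1^\top+\boldsymbol x\mathbf 1^\top+\mathbf 1\boldsymbol x^\top)\big\rangle$$ subject to $(\boldsymbol x^1,\mathbf M^1),(\boldsymbol x,\mathbf M)\in\mathcal C_{\mathrm{SDP}}(n)$, $\boldsymbol x^1+(K-1)\boldsymbol x=(2-K)\mathbf 1$, $x^1_1=1$. Problem $\mathcal R^{\mathrm b}_{\mathrm{LP}}$ is obtained by replacing $\mathcal C_{\mathrm{SDP}}(n)$ with $\mathcal C_{\mathrm{LP}}(n)$. Rounding algorithm for balanced clustering. Input: index set $\mathcal I_1=\{1,\dots,N\}$,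 cluster size $n\in\mathbb N$, $K=N/n\in\mathbb N$. For $k=1,\dots,K-1$: (a) solve $\mathcal R^{\mathrm b}_{\mathrm{SDP}}$ or $\mathcal R^{\mathrm b}_{\mathrm{LP}}$ for the datapoints $\boldsymbol\xi_i$, $i\in\mathcal I_k$ (i.e. with $N$ replaced by $|\mathcal I_k|$, $K$ replaced by $|\mathcal I_k|/n$, $\mathbf D$ restricted to $\mathcal I_k$, and the constraint $x_1^1=1$ imposed on the first datapoint of $\mathcal I_k$), and record the $\boldsymbol x^1\in\mathbb R^{|\mathcal I_k|}$ of an (arbitrary) optimal solution, with entries indexed by $\mathcal I_k$; (b) determine a bijection $\rho:\{1,\dots,|\mathcal I_k|\}\to\mathcal I_k$ with $x^1_{\rho(1)}\ge x^1_{\rho(2)}\ge\dots\ge x^1_{\rho(|\mathcal I_k|)}$; (c) set $I_k=\{\rho(1),\dots,\rho(n)\}$ and $\mathcal I_{k+1}=\mathcal I_k\setminus I_k$. Finally set $I_K=\mathcal I_K$. Output: $I_1,\dots,I_K$. *)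

(* Defs.v *)
From HB Require Import structures.
From mathcomp Require Export all_boot all_order all_algebra perm.
From mathcomp Require Export boolp classical_sets reals constructive_ereal ereal.

Set Implicit Arguments.
Unset Strict Implicit.
Unset Printing Implicit Defensive.

Import Order.TTheory GRing.Theory Num.Theory.

Local Open Scope ring_scope.

(* The infimum of the empty set is +oo. *)
Definition opt_value (R : realType) (T : Type) (S : set T) (f : T -> R) :
    \bar R :=
  ereal_inf [set (f z)%:E | z in S]%classic.

Definition minimizer (R : realType) (T : Type) (S : set T) (f : T -> R)
    (z : T) : Prop :=
  S z /\ forall y, S y -> f z <= f y.

(* The library norm on ['rV[R]_d] is the sup norm, hence this definition. *)
Definition enorm (R : realType) (d : nat) (v : 'rV[R]_d) : R :=
  Num.sqrt (\sum_(l < d) v 0 l ^+ 2).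

Definition sqdist (R : realType) (d N : nat) (xi : 'I_N -> 'rV[R]_d) :
    'M[R]_N :=
  \matrix_(i, j) enorm (xi i - xi j) ^+ 2.

(* Clusters are indexed by ['I_K]; nonemptiness is left to the cardinality
   conditions. *)
Definition is_partition (N K : nat) (J : 'I_K -> {set 'I_N}) : Prop :=
  (forall i, exists k, i \in J k) /\
  (forall k1 k2, k1 != k2 -> [disjoint J k1 & J k2]).

(* The conventions max = -oo and min = +oo over the empty set are needed for
   the minimum when K = 1. *)
Definition max_intra (R : realType) (N K : nat) (D : 'M[R]_N)
    (J : 'I_K -> {set 'I_N}) : \bar R :=
  \big[maxe/-oo%E]_(k < K)
    \big[maxe/-oo%E]_(i in J k) \big[maxe/-oo%E]_(j in J k) (D i j)%:E.

Definition min_inter (R : realType) (N K : nat) (D : 'M[R]_N)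
    (J : 'I_K -> {set 'I_N}) : \bar R :=
  \big[mine/+oo%E]_(k1 < K) \big[mine/+oo%E]_(k2 < K | (k1 < k2)%N)
    \big[mine/+oo%E]_(i in J k1) \big[mine/+oo%E]_(j in J k2) (D i j)%:E.

(* A point is [(p, e)] with [p i k] for pi_i^k and [e i j k] for eta_ij^k. *)
Definition P_point (R : realType) (N K : nat) : Type :=
  (('I_N -> 'I_K -> R) * ('I_N -> 'I_N -> 'I_K -> R))%type.

Definition P_obj (R : realType) (N K : nat) (sz : 'I_K -> nat) (D : 'M[R]_N)
    (z : P_point R N K) : R :=
  2^-1 * \sum_(k < K) (sz k)%:R^-1 *
           (\sum_(i < N) \sum_(j < N) D i j * z.2 i j k).

Definition P_feasible (R : realType) (N K : nat) (sz : 'I_K -> nat) :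
    set (P_point R N K) :=
  fun z => let: (p, e) := z in
    [/\ (forall i k, p i k = 0 \/ p i k = 1) /\ (forall i j k, 0 <= e i j k),
        forall k, \sum_(i < N) p i k = (sz k)%:R,
        forall i, \sum_(k < K) p i k = 1
      & forall i j k, p i k + p j k - 1 <= e i j k].

Definition clustering_point (R : realType) (N K : nat)
    (J : 'I_K -> {set 'I_N}) : P_point R N K :=
  let p (i : 'I_N) (k : 'I_K) : R := if i \in J k then 1 else 0 in
  (p, fun i j k => Num.max (p i k + p j k - 1) 0).

Definition psd (R : realType) (N : nat) (A : 'M[R]_N) : Prop :=
  A \is symmetricmx /\ forall v : 'cV[R]_N, 0 <= (v^T *m A *m v) 0 0.

Definition mx_ge0 (R : realType) (m n : nat) (A : 'M[R]_(m, n)) : Prop :=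
  forall i j, 0 <= A i j.

Definition mx_le0 (R : realType) (m n : nat) (A : 'M[R]_(m, n)) : Prop :=
  forall i j, A i j <= 0.

Definition ones (R : realType) (N : nat) : 'cV[R]_N := const_mx 1.
Arguments ones {R N}.

Definition C_LP (R : realType) (N n : nat) : set ('cV[R]_N * 'M[R]_N) :=
  fun z => let: (x, M) := z in
    let c : R := (2 * n)%:R - N%:R in
    [/\ M \is symmetricmx,
        [/\ ones^T *m x = c%:M, M *m ones = c *: x & forall i, M i i = 1]
      & [/\ mx_ge0 (M + ones *m ones^T + x *m ones^T + ones *m x^T),
            mx_ge0 (M + ones *m ones^T - x *m ones^T - ones *m x^T),
            mx_le0 (M - ones *m ones^T + x *m ones^T - ones *m x^T)
          & mx_le0 (M - ones *m ones^T - x *m ones^T + ones *m x^T)]].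

Definition C_SDP (R : realType) (N n : nat) : set ('cV[R]_N * 'M[R]_N) :=
  fun z => C_LP n z /\ psd (z.2 - z.1 *m z.1^T).

Inductive relaxation := SDP | LP.

Definition C_relax (r : relaxation) (R : realType) (N n : nat) :
    set ('cV[R]_N * 'M[R]_N) :=
  match r with SDP => @C_SDP R N n | LP => @C_LP R N n end.

(* A point is [((x1, M1), (x, M))]. *)
Definition Rb_point (R : realType) (N : nat) : Type :=
  (('cV[R]_N * 'M[R]_N) * ('cV[R]_N * 'M[R]_N))%type.

Definition Rb_obj (R : realType) (N n : nat) (D : 'M[R]_N)
    (z : Rb_point R N) : R :=
  let: ((x1, M1), (x, M)) := z in
  let K : R := N%:R / n%:R in
  (8 * n)%:R^-1 *
    \tr (D *m (M1 + ones *m ones^T + x1 *m ones^T + ones *m x1^T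
               + (K - 1) *: (M + ones *m ones^T + x *m ones^T
                             + ones *m x^T))).

Definition Rb_feasible (r : relaxation) (R : realType) (N n : nat) :
    set (Rb_point R N) :=
  fun z => let: ((x1, M1), (x, M)) := z in
    let K : R := N%:R / n%:R in
    [/\ C_relax r n (x1, M1), C_relax r n (x, M),
        x1 + (K - 1) *: x = (2 - K) *: ones
      & forall i : 'I_N, i = 0%N :> nat -> x1 i 0 = 1].

(* [enum_val : 'I_#|A| -> 'I_N] lists the elements of [A] in increasing order,
   so that position 0 is the first datapoint of [A]. *)
Definition restr (R : realType) (N : nat) (D : 'M[R]_N) (A : {set 'I_N}) :
    'M[R]_#|A| :=
  mxsub (fun a : 'I_#|A| => enum_val a) (fun b : 'I_#|A| => enum_val b) D.

Definition Rb_solution (r : relaxation) (R : realType) (N n : nat)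
    (D : 'M[R]_N) (A : {set 'I_N}) (z : Rb_point R #|A|) : Prop :=
  minimizer (@Rb_feasible r R #|A| n) (Rb_obj n (restr D A)) z.

(* One iteration on the index set [A], extracting the cluster [I]. The
   bijection rho from positions to [A] is [enum_val \o s]. *)
Definition rounding_step (r : relaxation) (R : realType) (N n : nat)
    (D : 'M[R]_N) (A I : {set 'I_N}) : Prop :=
  exists (z : Rb_point R #|A|) (s : {perm 'I_#|A|}),
    [/\ Rb_solution r n D z,
        forall a b : 'I_#|A|, (a <= b)%N -> z.1.1 (s b) 0 <= z.1.1 (s a) 0
      & I = [set enum_val (s a) | a : 'I_#|A| & (a < n)%N]%SET].

(* The first [m] iterations, numbered from 0: [act k] is the index set at the
   beginning of iteration [k], [I k] is the cluster extracted in it, and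
   [rel k] tells which of the two relaxations is solved in it. *)
Definition rounding_trace (rel : nat -> relaxation) (R : realType) (N n : nat)
    (D : 'M[R]_N) (m : nat) (act I : nat -> {set 'I_N}) : Prop :=
  act 0%N = [set: 'I_N]%SET /\
  forall k, (k < m)%N ->
    rounding_step (rel k) n D (act k) (I k) /\
    act k.+1 = (act k :\: I k)%SET.

(* The clusters [I 0, ..., I K.-1] are a possible output of the algorithm. *)
Definition rounding_output (rel : nat -> relaxation) (R : realType)
    (N K n : nat) (D : 'M[R]_N) (I : 'I_K -> {set 'I_N}) : Prop :=
  exists act J : nat -> {set 'I_N},
    [/\ rounding_trace rel n D K.-1 act J,
        J K.-1 = act K.-1
      & forall k : 'I_K, I k = J k].

(* The algorithm returns [J] up to relabeling whatever the choices of optimal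
   solutions and of sorting bijections: it never reaches a problem without
   optimal solution, it has an output, and each of its outputs is [J]. *)
Definition rounding_recovers (rel : nat -> relaxation) (R : realType)
    (N K n : nat) (D : 'M[R]_N) (J : 'I_K -> {set 'I_N}) : Prop :=
  [/\ forall m act I, (m < K.-1)%N -> rounding_trace rel n D m act I ->
        exists z : Rb_point R #|act m|, Rb_solution (rel m) n D z,
      exists I : 'I_K -> {set 'I_N}, rounding_output rel n D I
    & forall I : 'I_K -> {set 'I_N}, rounding_output rel n D I ->
        exists s : {perm 'I_K}, forall k, I k = J (s k)].

(* Main.v *)
(* For a feasible point of the balanced relaxation, the matrix
   T = (M^1 + 11' + x^1 1' + 1 x^1' + (K - 1) (M + 11' + x 1' + 1 x')) / 4 has
   entries in [0, 1] and row sums n, and the objective is <D, T> / (2 n). Under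
   the separation hypothesis, the n smallest entries in row i of D are those of
   the cluster of i, so <D, T> is minimal exactly when T is the indicator of "in
   the same cluster". In that case the linear constraints force x^1 to be 1 on
   the cluster of the first point and -1 elsewhere, so that each rounding step
   extracts a cluster, and the remaining points again satisfy the hypothesis.
   The bound is attained, already by the SDP relaxation, at averages of points
   (x, x x') with x a +-1 cluster indicator. The same bound applied to
   t_ij = sum_k pi_i^k pi_j^k gives the optimality of the clustering in P. *)
Require Import Defs.
From mathcomp Require Import ring lra.
Set Implicit Arguments.
Unset Strict Implicit.
Import Order.TTheory GRing.Theory Num.Theory.
Local Open Scope ring_scope.

(** * Optimal values, and the constraints of the LP relaxation read entrywise *)

Lemma opt_value_minimizer (R : realType) (T : Type) (S : set T) (f : T -> R)
    (z : T) :
  minimizer S f z -> opt_value S f = (f z)%:E.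
Proof.
move=> [Sz zmin]; apply/eqP; rewrite eq_le; apply/andP; split.
  by apply: ereal_inf_lbound; exists z.
by apply: le_ereal_inf_tmp => _ [y Sy <-]; rewrite lee_fin; apply: zmin.
Qed.

(** These are the McCormick inequalities for [M i j] as a linearization of the product
    [x i 0 * x j 0] over [-1, 1]: each one expands a product of two factors of the form 1 ± x. *)
Definition entry_bounds (R : realType) (N : nat) (x : 'cV[R]_N)
    (M : 'M[R]_N) : Prop :=
  forall i j, [/\ 0 <= M i j + 1 + x i 0 + x j 0,
                  0 <= M i j + 1 - x i 0 - x j 0,
                  M i j - 1 + x i 0 - x j 0 <= 0
                & M i j - 1 - x i 0 + x j 0 <= 0].

Lemma C_LP_entries (R : realType) (N n : nat) (x : 'cV[R]_N) (M : 'M[R]_N) :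
  C_LP n (x, M) <->
  [/\ forall i j, M i j = M j i,
      \sum_i x i 0 = (2 * n)%:R - N%:R,
      forall i, \sum_j M i j = ((2 * n)%:R - N%:R) * x i 0,
      forall i, M i i = 1
    & entry_bounds x M].
Proof.
have symE : (M \is symmetricmx) <-> forall i j, M i j = M j i.
  rewrite is_hermitianmxE expr0 scale1r map_mx_id //.
  split=> [/eqP MT i j|MT]; first by rewrite [in LHS]MT mxE.
  by apply/eqP/matrixP => i j; rewrite mxE.
have sumE : (ones^T *m x = ((2 * n)%:R - N%:R)%:M) <->
    \sum_i x i 0 = (2 * n)%:R - N%:R.
  have e : (ones^T *m x) 0 0 = \sum_i x i 0.
    by rewrite mxE; apply: eq_bigr => i _; rewrite !mxE mul1r.
  split=> [h|h]; first by rewrite -e h mxE eqxx mulr1n.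
  by apply/matrixP => i j; rewrite !ord1 e h mxE eqxx mulr1n.
have rowE : (M *m ones = ((2 * n)%:R - N%:R) *: x) <->
    forall i, \sum_j M i j = ((2 * n)%:R - N%:R) * x i 0.
  have e i : (M *m ones) i 0 = \sum_j M i j.
    by rewrite mxE; apply: eq_bigr => j _; rewrite !mxE mulr1.
  split=> [h i|h]; first by rewrite -e h mxE.
  by apply/matrixP => i j; rewrite !ord1 e h mxE.
split.
- case=> /symE h1 [/sumE h2 /rowE h3 h4] [h5 h6 h7 h8].
  split=> // i j; move: (h5 i j) (h6 i j) (h7 i j) (h8 i j).
  by rewrite !mxE !big_ord1 !mxE !mulr1 !mul1r.
- case=> /symE h1 /sumE h2 /rowE h3 h4 h5.
  split=> //; split=> i j; case: (h5 i j);
    by rewrite !mxE !big_ord1 !mxE !mulr1 !mul1r.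
Qed.

(** * Lower bound on the cost of row-normalized weights *)

Section BalancedClusters.
Variables (R : realType) (N n : nat) (T : finType) (cl : 'I_N -> T).
(** Points are labelled by [cl], and only the labels in [S] carry a cluster. [S] is the set of all
    labels for the full problem and the set of remaining labels in a rounding step. *)
Variable (S : {set T}).
Hypothesis n_gt0 : (0 < n)%N.
Hypothesis clS : forall i, cl i \in S.
Hypothesis cardS : forall k, k \in S -> #|[set i | cl i == k]| = n.

Local Notation chi k i := ((cl i == k)%:R : R).

Lemma sum_chi k : k \in S -> \sum_i chi k i = n%:R.
Proof.
move=> kS; rewrite -(cardS kS) -sum1_card natr_sum [RHS]big_mkcond /=.
by apply: eq_bigr => i _; rewrite inE; case: ifP.
Qed.

Lemma sum_same i : \sum_j (cl i == cl j)%:R = n%:R :> R.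
Proof.
by rewrite -(sum_chi (clS i)); apply: eq_bigr => j _; rewrite eq_sym.
Qed.

Lemma sum_chiS i (F : T -> R) : \sum_(k in S) F k * chi k i = F (cl i).
Proof.
rewrite (bigD1 (cl i)) //= eqxx mulr1 big1 ?addr0 // => k /andP[_ kN].
by rewrite eq_sym (negPf kN) mulr0.
Qed.

Lemma card_clusters : N = (#|S| * n)%N.
Proof.
transitivity (\sum_(i < N) 1)%N; first by rewrite sum1_card card_ord.
rewrite (partition_big cl (mem S)) //=.
rewrite -sum_nat_const; apply: eq_bigr => k kS.
by rewrite -(cardS kS) -sum1dep_card.
Qed.

Section LowerBound.
Variables (D : 'M[R]_N) (c : R).
Hypothesis D_intra : forall i j, cl i = cl j -> D i j <= c.
Hypothesis D_inter : forall i j, cl i != cl j -> c < D i j.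
Variable t : 'I_N -> 'I_N -> R.
Hypothesis t01 : forall i j, 0 <= t i j <= 1.
Hypothesis sum_t : forall i, \sum_j t i j = n%:R.

Let excess i j := (D i j - c) * (t i j - (cl i == cl j)%:R).

(** Inside a cluster both factors are nonpositive, across two clusters both are nonnegative. *)
Lemma excess_ge0 i j : 0 <= excess i j.
Proof.
rewrite /excess; have /andP[t0 t1] := t01 i j.
case: eqP => [/D_intra|/eqP /D_inter] Dc.
  by rewrite mulr_le0 // subr_le0.
by rewrite subr0 mulr_ge0 // subr_ge0 ltW.
Qed.

(* Subtracting the threshold [c] from [D] changes neither side, as the rows of
   [t] and of the cluster indicator have the same sum. *)
Lemma sum_excess : \sum_i \sum_j excess i j =
  \sum_i \sum_j D i j * t i j - \sum_i \sum_j D i j * (cl i == cl j)%:R.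
Proof.
rewrite -sumrB; apply: eq_bigr => i _.
have : \sum_j c * (t i j - (cl i == cl j)%:R) = 0.
  by rewrite -mulr_sumr sumrB sum_t sum_same subrr mulr0.
move=> c0; rewrite -sumrB; transitivity
  (\sum_j (D i j * t i j - D i j * (cl i == cl j)%:R)
   - \sum_j c * (t i j - (cl i == cl j)%:R)); last by rewrite c0 subr0.
by rewrite -sumrB; apply: eq_bigr => j _; rewrite /excess; ring.
Qed.

Lemma intra_cost_le :
  \sum_i \sum_j D i j * (cl i == cl j)%:R <= \sum_i \sum_j D i j * t i j.
Proof.
rewrite -subr_ge0 -sum_excess.
by apply: sumr_ge0 => i _; apply: sumr_ge0 => j _; apply: excess_ge0.
Qed.

(** Equality makes every excess vanish. Across clusters [D i j - c] is positive, so [t i j] is 0.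
    Inside a cluster [D i j] may equal [c], so there the row sum decides: n entries bounded by 1
    have sum n, hence all are 1. *)
Lemma intra_cost_eq :
  \sum_i \sum_j D i j * t i j <= \sum_i \sum_j D i j * (cl i == cl j)%:R ->
  forall i j, t i j = (cl i == cl j)%:R.
Proof.
move=> le; have {le} sum0 : \sum_i \sum_j excess i j = 0.
  by rewrite sum_excess; apply/eqP; rewrite subr_eq0 eq_le le intra_cost_le.
have ex0 i j : excess i j = 0.
  apply: (psumr_eq0P _ (_ : \sum_j excess i j = 0)) => // [k _|].
    exact: excess_ge0.
  apply: (psumr_eq0P _ sum0) => // k _.
  by apply: sumr_ge0 => l _; apply: excess_ge0.
have t0 i j : cl i != cl j -> t i j = 0.
  move=> ij; have /eqP := ex0 i j; rewrite /excess (negPf ij) subr0 mulf_eq0.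
  by rewrite subr_eq0 gt_eqF ?D_inter //= => /eqP.
move=> i j; case: (eqVneq (cl i) (cl j)) => [ij|/t0 //].
have d0 k : true -> 0 <= (cl i == cl k)%:R - t i k.
  move=> _; case: (eqVneq (cl i) (cl k)) => [_|/t0->]; last by rewrite subr0.
  by rewrite subr_ge0; have /andP[] := t01 i k.
have ds : \sum_k ((cl i == cl k)%:R - t i k) = 0.
  by rewrite sumrB sum_t sum_same subrr.
move/eqP: (psumr_eq0P d0 ds (erefl : xpredT j)).
by rewrite ij eqxx subr_eq0 => /eqP.
Qed.

End LowerBound.
End BalancedClusters.

(** * Weights of a feasible point of the balanced relaxation *)

Definition lifted (R : realType) (N : nat) (z : 'cV[R]_N * 'M[R]_N)
    (i j : 'I_N) : R :=
  z.2 i j + 1 + z.1 i 0 + z.1 j 0.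

(* In the encoding x = 2 pi - 1, [lifted] is 4 pi pi^T, so that [Rb_weight]
   plays the role of sum_k pi^k (pi^k)^T. *)
Definition Rb_weight (R : realType) (N n : nat) (z : Rb_point R N)
    (i j : 'I_N) : R :=
  (lifted z.1 i j + (N%:R / n%:R - 1) * lifted z.2 i j) / 4.

Lemma lifted_sym (R : realType) (N n : nat) (z : 'cV[R]_N * 'M[R]_N) i j :
  C_LP n z -> lifted z i j = lifted z j i.
Proof.
case: z => x M /C_LP_entries[Msym _ _ _ _].
by rewrite /lifted /= Msym -!addrA (addrC (x i 0)).
Qed.

Lemma lifted_row_sum (R : realType) (N n : nat) (z : 'cV[R]_N * 'M[R]_N) i :
  C_LP n z -> \sum_j lifted z i j = (2 * n)%:R * (1 + z.1 i 0).
Proof.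
case: z => x M /C_LP_entries[_ sum_x row_M _ _] /=; rewrite /lifted /=.
rewrite !big_split /= row_M sum_x !sumr_const card_ord -[x i 0 *+ N]mulr_natr.
by ring.
Qed.

(** With x = 2 pi - 1, the McCormick bounds say that [lifted] lies above 0 and 4 (pi_i + pi_j - 1),
    and below 4 pi_i and 4 pi_j. *)
Lemma lifted_bounds (R : realType) (N n : nat) (z : 'cV[R]_N * 'M[R]_N) i j :
  C_LP n z ->
  [/\ 0 <= lifted z i j, 2 * (z.1 i 0 + z.1 j 0) <= lifted z i j,
      lifted z i j <= 2 * (1 + z.1 i 0) & lifted z i j <= 2 * (1 + z.1 j 0)].
Proof.
case: z => x M /C_LP_entries[_ _ _ _ /(_ i j)[]]; rewrite /lifted /=.
by move=> h1 h2 h3 h4; split; lra.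
Qed.

Lemma C_relax_LP (R : realType) (r : relaxation) (N n : nat)
    (z : 'cV[R]_N * 'M[R]_N) :
  C_relax r n z -> C_LP n z.
Proof. by case: r => // -[]. Qed.

Lemma Rb_obj_weight (R : realType) (r : relaxation) (N n : nat) (D : 'M[R]_N)
    (z : Rb_point R N) :
  Rb_feasible r n z ->
  Rb_obj n D z = (2 * n)%:R^-1 * \sum_i \sum_j D i j * Rb_weight n z i j.
Proof.
case: z => [[x1 M1] [x M]] [/C_relax_LP h1 /C_relax_LP h2 _ _].
rewrite /Rb_obj; have -> : (8 * n)%:R^-1 = (2 * n)%:R^-1 / 4 :> R.
  by rewrite -invfM -natrM mulnAC.
rewrite -mulrA; congr (_ * _); rewrite /mxtrace mulr_sumr.
apply: eq_bigr => i _; rewrite mxE mulr_sumr; apply: eq_bigr => j _.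
(* The trace pairs [D i j] with the entry (j, i) of the other factor, hence the symmetry of
   [lifted]. *)
rewrite /Rb_weight /= (lifted_sym i j h1) (lifted_sym i j h2) /lifted /=.
by rewrite !mxE !big_ord1 !mxE !mulr1 !mul1r; ring.
Qed.

Section Relaxation.
Variables (R : realType) (N n : nat) (r : relaxation) (z : Rb_point R N).
Hypothesis n_gt0 : (0 < n)%N.
Hypothesis le_nN : (n <= N)%N.
Hypothesis z_feas : Rb_feasible r n z.

Let K : R := N%:R / n%:R.

Lemma Rb_feasible_LP : C_LP n z.1 /\ C_LP n z.2.
Proof.
by case: z z_feas => [[x1 M1] [x M]] [/C_relax_LP h1 /C_relax_LP h2 _ _].
Qed.

Lemma Rb_feasible_sum i : z.1.1 i 0 + (K - 1) * z.2.1 i 0 = 2 - K.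
Proof.
case: z z_feas => [[x1 M1] [x M]] [_ _ /matrixP/(_ i 0) + _] /=.
by rewrite !mxE mulr1.
Qed.

Lemma ratio_ge1 : 1 <= K.
Proof. by rewrite ler_pdivlMr ?ltr0n // mul1r ler_nat. Qed.

(** For the upper bound, four times the weight is at most 2 (1 + x^1_i) + 2 (K - 1) (1 + x_i), which
    the constraint linking x^1 and x makes equal to 4. *)
Lemma Rb_weight_01 i j : 0 <= Rb_weight n z i j <= 1.
Proof.
have [h1 h2] := Rb_feasible_LP; have K1 := ratio_ge1.
have [a1 _ b1 _] := lifted_bounds i j h1.
have [a2 _ b2 _] := lifted_bounds i j h2.
have e := Rb_feasible_sum i; rewrite /Rb_weight -/K.
have c1 : 0 <= (K - 1) * lifted z.2 i j by rewrite mulr_ge0 ?subr_ge0.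
have c2 : (K - 1) * lifted z.2 i j <= (K - 1) * (2 * (1 + z.2.1 i 0)).
  by rewrite ler_wpM2l ?subr_ge0.
by apply/andP; split; lra.
Qed.

Lemma Rb_weight_row_sum i : \sum_j Rb_weight n z i j = n%:R.
Proof.
have [h1 h2] := Rb_feasible_LP.
rewrite -mulr_suml big_split /= -mulr_sumr.
rewrite (lifted_row_sum i h1) (lifted_row_sum i h2) -/K.
have := Rb_feasible_sum i; set a := z.1.1 i 0; set b := z.2.1 i 0 => e.
have -> : (2 * n)%:R * (1 + a) + (K - 1) * ((2 * n)%:R * (1 + b)) =
  (2 * n)%:R * (a + (K - 1) * b + K) by ring.
by rewrite e natrM; field.
Qed.

(** A weight of 1 makes the upper bounds in terms of [i] tight, and likewise those in terms of [j].
    The lifted entry of the first pair thus equals both 2 (1 + x^1_i) and 2 (1 + x^1_j). *)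
Lemma Rb_weight_eq1 i j : Rb_weight n z i j = 1 -> z.1.1 i 0 = z.1.1 j 0.
Proof.
have [h1 h2] := Rb_feasible_LP; have K1 := ratio_ge1.
have [_ _ a1 b1] := lifted_bounds i j h1.
have [_ _ a2 b2] := lifted_bounds i j h2.
have ei := Rb_feasible_sum i; have ej := Rb_feasible_sum j.
rewrite /Rb_weight -/K => w1.
have ci : (K - 1) * lifted z.2 i j <= (K - 1) * (2 * (1 + z.2.1 i 0)).
  by rewrite ler_wpM2l ?subr_ge0.
have cj : (K - 1) * lifted z.2 i j <= (K - 1) * (2 * (1 + z.2.1 j 0)).
  by rewrite ler_wpM2l ?subr_ge0.
by lra.
Qed.

(** Both summands of the weight are nonnegative, so the lifted entry of the first pair is 0. With
    x^1_i = 1, its lower bound 2 (x^1_i + x^1_j) gives x^1_j <= -1 and its upper bound 2 (1 + x^1_j)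
    gives the converse. *)
Lemma Rb_weight_eq0 i j :
  Rb_weight n z i j = 0 -> z.1.1 i 0 = 1 -> z.1.1 j 0 = -1.
Proof.
have [h1 h2] := Rb_feasible_LP; have K1 := ratio_ge1.
have [a1 b1 _ d1] := lifted_bounds i j h1.
have [a2 _ _ _] := lifted_bounds i j h2.
have c1 : 0 <= (K - 1) * lifted z.2 i j by rewrite mulr_ge0 ?subr_ge0.
by rewrite /Rb_weight -/K => w0 xi1; lra.
Qed.

End Relaxation.

(** * Averages of cluster sign vectors attain the bound *)

Lemma C_SDP_relax (R : realType) (r : relaxation) (N n : nat)
    (z : 'cV[R]_N * 'M[R]_N) :
  C_SDP n z -> C_relax r n z.
Proof. by case: r => // -[]. Qed.

Lemma psd_sum_outer (R : realType) (N : nat) (T : finType) (P : {pred T})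
    (w : T -> R) (u : T -> 'cV[R]_N) :
  (forall k, k \in P -> 0 <= w k) ->
  psd (\sum_(k in P) w k *: (u k *m (u k)^T)).
Proof.
move=> w0; split.
  rewrite is_hermitianmxE expr0 scale1r map_mx_id //; apply/eqP/matrixP => i j.
  rewrite !mxE !summxE; apply: eq_bigr => k _.
  by rewrite !mxE !big_ord1 !mxE [u k i 0 * _]mulrC.
move=> v; rewrite mulmx_sumr mulmx_suml summxE; apply: sumr_ge0 => k kP.
rewrite -scalemxAr -scalemxAl mxE mulr_ge0 ?w0 //.
have -> : v^T *m (u k *m (u k)^T) *m v = (v^T *m u k) *m (v^T *m u k)^T.
  by rewrite trmx_mul trmxK !mulmxA.
by rewrite mxE big_ord1 [_^T 0 0]mxE -expr2 sqr_ge0.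
Qed.

Section Mixture.
Variables (R : realType) (N n : nat) (T : finType) (cl : 'I_N -> T).
Variable S : {set T}.
Hypothesis n_gt0 : (0 < n)%N.
Hypothesis clS : forall i, cl i \in S.
Hypothesis cardS : forall k, k \in S -> #|[set i | cl i == k]| = n.

Definition sgn_vec (k : T) : 'cV[R]_N := \col_i (2 * (cl i == k)%:R - 1).

(** For weights [w] of a probability on [S], this is the mean of the integral points (s, s s^T) over
    the clusters. *)
Definition mix (w : T -> R) : 'cV[R]_N * 'M[R]_N :=
  (\sum_(k in S) w k *: sgn_vec k,
   \sum_(k in S) w k *: (sgn_vec k *m (sgn_vec k)^T)).

Local Notation s k i := (2 * (cl i == k)%:R - 1 : R).

Lemma mix1E w i : (mix w).1 i 0 = \sum_(k in S) w k * s k i.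
Proof. by rewrite summxE; apply: eq_bigr => k _; rewrite !mxE. Qed.

Lemma mix2E w i j : (mix w).2 i j = \sum_(k in S) w k * (s k i * s k j).
Proof.
by rewrite summxE; apply: eq_bigr => k _; rewrite !mxE big_ord1 !mxE.
Qed.

Lemma sgn_pm1 k i : s k i = 1 \/ s k i = -1.
Proof.
by case: eqP => _; [left|right]; rewrite ?mulr1 ?mulr0 ?sub0r //; ring.
Qed.

Lemma sum_sgn k : k \in S -> \sum_i s k i = (2 * n)%:R - N%:R.
Proof.
move=> kS; rewrite sumrB -mulr_sumr (sum_chi R cardS kS) sumr_const card_ord.
by rewrite natrM.
Qed.

Section Weights.
Variable w : T -> R.
Hypothesis w_ge0 : forall k, k \in S -> 0 <= w k.
Hypothesis sum_w : \sum_(k in S) w k = 1.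

(** All constraints are affine in (x, M), so they pass from the sign vectors to their averages. *)
Lemma mix_LP : C_LP n (mix w).
Proof.
rewrite [mix w]surjective_pairing; apply/C_LP_entries; split.
- move=> i j; rewrite !mix2E; apply: eq_bigr => k _.
  by rewrite [s k i * _]mulrC.
- rewrite (eq_bigr _ (fun i _ => mix1E w i)) exchange_big /=.
  transitivity (\sum_(k in S) w k * ((2 * n)%:R - N%:R)).
    by apply: eq_bigr => k kS; rewrite -mulr_sumr sum_sgn.
  by rewrite -mulr_suml sum_w mul1r.
- move=> i; rewrite (eq_bigr _ (fun j _ => mix2E w i j)) exchange_big /=.
  rewrite mix1E mulr_sumr; apply: eq_bigr => k kS.
  by rewrite -mulr_sumr -mulr_sumr sum_sgn //; ring.
- move=> i; rewrite mix2E -[RHS]sum_w; apply: eq_bigr => k _.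
  by case: (sgn_pm1 k i) => ->; ring.
(* An affine expression of the average is the average of that expression at the sign vectors;
   [sum_w] absorbs the constant term [e]. *)
- move=> i j; have lin a b c e : e + a * (mix w).2 i j + b * (mix w).1 i 0
      + c * (mix w).1 j 0 =
      \sum_(k in S) w k * (e + a * (s k i * s k j) + b * s k i + c * s k j).
    rewrite mix2E !mix1E !mulr_sumr -[in LHS](mulr1 e) -{1}sum_w mulr_sumr.
    by rewrite -!big_split /=; apply: eq_bigr => k _; ring.
  have pos a b c e : (forall k, 0 <= e + a * (s k i * s k j) + b * s k i
      + c * s k j) -> 0 <= e + a * (mix w).2 i j + b * (mix w).1 i 0
      + c * (mix w).1 j 0.
    by move=> h; rewrite lin; apply: sumr_ge0 => k kS; rewrite mulr_ge0 ?w_ge0.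
  have sgnE k : [/\ 0 <= 1 + 1 * (s k i * s k j) + 1 * s k i + 1 * s k j,
      0 <= 1 + 1 * (s k i * s k j) + -1 * s k i + -1 * s k j,
      0 <= 1 + -1 * (s k i * s k j) + -1 * s k i + 1 * s k j
    & 0 <= 1 + -1 * (s k i * s k j) + 1 * s k i + -1 * s k j].
    by case: (sgn_pm1 k i) => ->; case: (sgn_pm1 k j) => ->; split; lra.
  have p1 := pos _ _ _ _ (fun k => let: And4 h _ _ _ := sgnE k in h).
  have p2 := pos _ _ _ _ (fun k => let: And4 _ h _ _ := sgnE k in h).
  have p3 := pos _ _ _ _ (fun k => let: And4 _ _ h _ := sgnE k in h).
  have p4 := pos _ _ _ _ (fun k => let: And4 _ _ _ h := sgnE k in h).
  by split; lra.
Qed.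

(** M - x x^T is the covariance matrix of the sign vectors under the probability [w]. *)
Lemma mix_SDP : C_SDP n (mix w).
Proof.
split; first exact: mix_LP.
suff -> : (mix w).2 - (mix w).1 *m (mix w).1^T =
    \sum_(k in S) w k *: ((sgn_vec k - (mix w).1) *m (sgn_vec k - (mix w).1)^T).
  exact: psd_sum_outer.
apply/matrixP => i j.
have -> : ((mix w).2 - (mix w).1 *m (mix w).1^T) i j =
    (mix w).2 i j - (mix w).1 i 0 * (mix w).1 j 0.
  by rewrite !mxE big_ord1 !mxE.
rewrite [RHS]summxE; under [RHS]eq_bigr => k _.
  rewrite !mxE big_ord1 !mxE.
  have -> (a b x y : R) : w k * ((a - x) * (b - y)) =
    w k * (a * b) - x * (w k * b) - y * (w k * a) + w k * (x * y) by ring.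
  over.
rewrite big_split !sumrB /= -!mulr_sumr -mulr_suml sum_w -mix2E -!mix1E.
by ring.
Qed.

(** Since 1 + s is twice a cluster indicator, only the term of a cluster containing both points
    survives. *)
Lemma lifted_mix i j : lifted (mix w) i j = 4 * w (cl i) * (cl i == cl j)%:R.
Proof.
rewrite /lifted mix2E !mix1E.
transitivity (\sum_(k in S) w k * (s k i * s k j) + \sum_(k in S) w k
  + \sum_(k in S) w k * s k i + \sum_(k in S) w k * s k j).
  by rewrite sum_w.
rewrite -!big_split /=.
transitivity (\sum_(k in S) 4 * w k * (cl j == k)%:R * (cl i == k)%:R).
  by apply: eq_bigr => k _; ring.
by rewrite (sum_chiS clS) [cl j == _]eq_sym.
Qed.

End Weights.

(** The first pair puts all its weight on the cluster [k1] of the first point, so that x^1_1 = 1.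
    The second is chosen so that [w1 k + (K - 1) * w2 k = 1] on every cluster of [S], which yields
    both the linking constraint and the value of the weights. *)
Lemma Rb_weight_attained (r : relaxation) : (0 < N)%N ->
  exists2 z : Rb_point R N, Rb_feasible r n z &
    forall i j, Rb_weight n z i j = (cl i == cl j)%:R.
Proof.
move=> N_gt0; pose k1 := cl (Ordinal N_gt0).
have k1S : k1 \in S by apply: clS.
have S_gt0 : (0 < #|S|)%N by apply/card_gt0P; exists k1.
pose K : R := #|S|%:R.
have KE : N%:R / n%:R = K.
  rewrite {1}(card_clusters clS cardS) natrM mulfK //.
  by rewrite pnatr_eq0 -lt0n.
pose w1 k : R := (k == k1)%:R.
(* The second pair averages the clusters other than [k1]; for [K = 1] it is
   multiplied by 0 and only has to be feasible. *)
pose w2 k : R := if #|S| == 1%N then w1 k else (1 - w1 k) / (K - 1).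
have K1 : #|S| != 1%N -> 0 < K - 1.
  by move=> h; rewrite subr_gt0 ltr1n ltn_neqAle eq_sym h.
(* The second alternative is the case of a single cluster, settled below once [k] is known to be
   [k1]. *)
have w12 k : w1 k + (K - 1) * w2 k = w1 k + (1 - w1 k) \/
   (#|S| = 1%N /\ w1 k + (K - 1) * w2 k = w1 k).
  rewrite /w2; case: eqP => [S1|/eqP /K1 K1']; [right|left].
    by split=> //; rewrite /K S1 subrr mul0r addr0.
  by congr (_ + _); rewrite mulrC divfK // gt_eqF.
have sum_w1 : \sum_(k in S) w1 k = 1.
  by rewrite (bigD1 k1) //= /w1 eqxx big1 ?addr0 // => k /andP[_ /negPf->].
have sum_w2 : \sum_(k in S) w2 k = 1.
  rewrite /w2; case: eqP => [_|/eqP /K1 K1']; first exact: sum_w1.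
  by rewrite -mulr_suml sumrB sum_w1 sumr_const divff // gt_eqF.
have w1_ge0 k : k \in S -> 0 <= w1 k by rewrite ler0n.
have w2_ge0 k : k \in S -> 0 <= w2 k.
  rewrite /w2; case: eqP => [_|/eqP /K1 K1']; first exact: w1_ge0.
  by move=> _; rewrite divr_ge0 ?(ltW K1') // subr_ge0 lern1 leq_b1.
have {}w12 k : k \in S -> w1 k + (K - 1) * w2 k = 1.
  move=> kS; case: (w12 k) => [->|[/eqP/cards1P[k2 S2] ->]].
    by rewrite addrC subrK.
  move: kS k1S; rewrite S2 !inE => /eqP-> /eqP<-; rewrite /w1 eqxx //.
exists (mix w1, mix w2).
  rewrite [mix w1]surjective_pairing [mix w2]surjective_pairing.
  rewrite /Rb_feasible KE -!surjective_pairing; split.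
  - exact/C_SDP_relax/mix_SDP.
  - exact/C_SDP_relax/mix_SDP.
  - apply/matrixP => i j; rewrite ord1 mxE mix1E [X in _ + X]mxE mix1E.
    rewrite mulr_sumr -big_split /= !mxE mulr1.
    transitivity (\sum_(k in S) (2 * (cl i == k)%:R - 1) : R).
      apply: eq_bigr => k kS; rewrite mulrA -mulrDl w12 ?mul1r //.
    by rewrite sumrB (sum_chiS clS i (fun=> 2)) sumr_const.
  - move=> i i0; have -> : i = Ordinal N_gt0 by apply: val_inj.
    rewrite mix1E; under eq_bigr => k _ do rewrite mulrBr mulrA mulr1.
    rewrite sumrB (sum_chiS clS _ (fun k => w1 k * 2)) sum_w1.
    by rewrite /w1 eqxx mul1r; ring.
move=> i j; rewrite /Rb_weight /= KE !lifted_mix //.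
transitivity ((w1 (cl i) + (K - 1) * w2 (cl i)) * (cl i == cl j)%:R).
  by field.
by rewrite w12 ?mul1r.
Qed.

End Mixture.

(** * Minimizers of the balanced relaxations *)

Section Minimizers.
Variables (R : realType) (N n : nat) (T : finType) (cl : 'I_N -> T).
Variable S : {set T}.
Hypothesis n_gt0 : (0 < n)%N.
Hypothesis clS : forall i, cl i \in S.
Hypothesis cardS : forall k, k \in S -> #|[set i | cl i == k]| = n.
Variables (D : 'M[R]_N) (c : R).
Hypothesis D_intra : forall i j, cl i = cl j -> D i j <= c.
Hypothesis D_inter : forall i j, cl i != cl j -> c < D i j.
Hypothesis N_gt0 : (0 < N)%N.
Variable r : relaxation.

Let opt : R := (2 * n)%:R^-1 * \sum_i \sum_j D i j * (cl i == cl j)%:R.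

Lemma cluster_size_le : (n <= N)%N.
Proof.
rewrite (card_clusters clS cardS) leq_pmull //; apply/card_gt0P.
by exists (cl (Ordinal N_gt0)).
Qed.

Lemma half_inv_gt0 : 0 < (2 * n)%:R^-1 :> R.
Proof. by rewrite invr_gt0 ltr0n muln_gt0. Qed.

Lemma Rb_obj_ge z : Rb_feasible r n z -> opt <= Rb_obj n D z.
Proof.
move=> zF; rewrite (Rb_obj_weight D zF) ler_pM2l ?half_inv_gt0 //.
apply: (intra_cost_le clS cardS D_intra D_inter) => [i j|i].
  exact: (Rb_weight_01 n_gt0 cluster_size_le zF).
exact: (Rb_weight_row_sum zF).
Qed.

Lemma Rb_minimizer_exists :
  exists2 z, minimizer (@Rb_feasible r R N n) (Rb_obj n D) z &
    Rb_obj n D z = opt.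
Proof.
have [z zF zw] := Rb_weight_attained R n_gt0 clS cardS r N_gt0.
have zopt : Rb_obj n D z = opt.
  rewrite (Rb_obj_weight D zF); congr (_ * _).
  by apply: eq_bigr => i _; apply: eq_bigr => j _; rewrite zw.
by exists z => //; split=> // y yF; rewrite zopt Rb_obj_ge.
Qed.

Lemma Rb_minimizer_weight z i j :
  minimizer (@Rb_feasible r R N n) (Rb_obj n D) z ->
  Rb_weight n z i j = (cl i == cl j)%:R.
Proof.
move=> [zF zmin]; apply: (intra_cost_eq clS cardS D_intra D_inter) => [k l|k|].
- exact: (Rb_weight_01 n_gt0 cluster_size_le zF).
- exact: (Rb_weight_row_sum zF).
have [y [yF _] yopt] := Rb_minimizer_exists.
by rewrite -(ler_pM2l half_inv_gt0) -(Rb_obj_weight D zF) -/opt -yopt zmin.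
Qed.

(** Row [i0] of the weights determines x^1: a weight of 1 copies the value 1 of the first point, and
    a weight of 0 forces -1. *)
Lemma Rb_minimizer_x1 z (i0 i : 'I_N) :
  minimizer (@Rb_feasible r R N n) (Rb_obj n D) z -> i0 = 0%N :> nat ->
  z.1.1 i 0 = if cl i == cl i0 then 1 else -1.
Proof.
move=> zmin i00; have [zF _] := zmin.
have x0 : z.1.1 i0 0 = 1 by case: z zF {zmin} => [[? ?] [? ?]] [_ _ _]; apply.
have := Rb_minimizer_weight i0 i zmin; rewrite [cl i == _]eq_sym.
case: eqP => _ w.
  by rewrite -(Rb_weight_eq1 n_gt0 cluster_size_le zF w).
exact: (Rb_weight_eq0 n_gt0 cluster_size_le zF w).
Qed.

End Minimizers.

(** * Optimality of the clustering in the problem P *)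

Section Clustering.
Variables (R : realType) (N K n : nat) (cl : 'I_N -> 'I_K).
Variable J : 'I_K -> {set 'I_N}.
Hypothesis n_gt0 : (0 < n)%N.
Hypothesis J_cl : forall i k, (i \in J k) = (cl i == k).
Hypothesis J_card : forall k, #|J k| = n.
Variables (D : 'M[R]_N) (c : R).
Hypothesis D_ge0 : forall i j, 0 <= D i j.
Hypothesis D_intra : forall i j, cl i = cl j -> D i j <= c.
Hypothesis D_inter : forall i j, cl i != cl j -> c < D i j.

Let opt : R := (2 * n)%:R^-1 * \sum_i \sum_j D i j * (cl i == cl j)%:R.

Lemma card_fiber k : #|[set i | cl i == k]| = n.
Proof. by rewrite -(J_card k); apply: eq_card => i; rewrite inE J_cl. Qed.

Lemma P_obj_sum (z : P_point R N K) :
  P_obj (fun=> n) D z =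
  (2 * n)%:R^-1 * \sum_i \sum_j D i j * \sum_k z.2 i j k.
Proof.
rewrite /P_obj natrM invfM -mulrA; congr (_ * _).
rewrite -mulr_sumr; congr (_ * _); rewrite exchange_big /=.
apply: eq_bigr => i _; rewrite exchange_big /=.
by apply: eq_bigr => j _; rewrite mulr_sumr.
Qed.

(** As [D] is nonnegative, each eta may be replaced by the product of the two pi, which for 0/1
    values is max (pi_i + pi_j - 1, 0) and so lies below every feasible eta. The sums over k of
    these products have row sums n. *)
Lemma P_obj_ge (z : P_point R N K) :
  P_feasible (fun=> n) z -> opt <= P_obj (fun=> n) D z.
Proof.
case: z => p e [[p01 e0] sum_p sum1 ple]; rewrite P_obj_sum /=.
rewrite ler_pM2l ?(half_inv_gt0 _ n_gt0) //.
have p_ge0 i k : 0 <= p i k by case: (p01 i k) => ->.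
have p_le1 i k : p i k <= 1 by case: (p01 i k) => ->.
apply: (@le_trans _ _ (\sum_i \sum_j D i j * \sum_k p i k * p j k)).
  apply: (intra_cost_le (S := [set: 'I_K]%SET) _ _ D_intra D_inter).
  - by move=> i; rewrite inE.
  - by move=> k _; apply: card_fiber.
  - move=> i j; apply/andP; split.
      by apply: sumr_ge0 => k _; rewrite mulr_ge0.
    by rewrite -(sum1 i); apply: ler_sum => k _; rewrite ler_piMr.
  - move=> i; transitivity (\sum_k p i k * n%:R); last first.
      by rewrite -mulr_suml sum1 mul1r.
    rewrite exchange_big /=.
    by apply: eq_bigr => k _; rewrite -mulr_sumr sum_p.
apply: ler_sum => i _; apply: ler_sum => j _; rewrite ler_wpM2l //.
apply: ler_sum => k _; have := ple i j k; have := e0 i j k.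
by case: (p01 i k) => ->; case: (p01 j k) => ->; lra.
Qed.

Lemma clustering_point_eta i j k :
  (clustering_point R J).2 i j k = (cl i == k)%:R * (cl j == k)%:R.
Proof.
rewrite /clustering_point /= !J_cl.
case: (cl i == k); case: (cl j == k);
  rewrite ?addrK ?addr0 ?add0r ?subrr ?mulr1 ?mulr0 ?maxxx //.
  by apply/max_idPl.
by apply/max_idPr; lra.
Qed.

Lemma clustering_point_obj :
  P_obj (fun=> n) D (clustering_point R J) = opt.
Proof.
rewrite P_obj_sum; congr (_ * _).
apply: eq_bigr => i _; apply: eq_bigr => j _; congr (_ * _).
under eq_bigr => k _ do rewrite clustering_point_eta.
rewrite (bigD1 (cl i)) //= eqxx mul1r big1 ?addr0 1?eq_sym // => k ki.
by rewrite eq_sym (negPf ki) mul0r.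
Qed.

Lemma clustering_point_minimizer :
  minimizer (@P_feasible R N K (fun=> n)) (P_obj (fun=> n) D)
    (clustering_point R J).
Proof.
split.
  split.
  - split=> [i k|i j k]; first by case: ifP; [right|left].
    by rewrite le_max lexx orbT.
  - move=> k; rewrite -(J_card k) -sum1_card natr_sum [RHS]big_mkcond /=.
    by apply: eq_bigr => i _; case: ifP.
  - move=> i; rewrite (bigD1 (cl i)) //= J_cl eqxx big1 ?addr0 // => k ki.
    by rewrite J_cl eq_sym (negPf ki).
  - by move=> i j k; rewrite le_max lexx.
by move=> y yF; rewrite clustering_point_obj P_obj_ge.
Qed.

End Clustering.

(** * Sorting permutations and exhaustion of a finite type *)

Lemma exists_decreasing_perm (R : realType) (m : nat) (x : 'I_m -> R) :
  exists s : {perm 'I_m}, forall a b : 'I_m, (a <= b)%N -> x (s b) <= x (s a).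
Proof.
pose le_x a b := x b <= x a.
pose t := sort le_x (enum 'I_m).
have t_perm : perm_eq t (ord_tuple m).
  by rewrite val_ord_tuple /t (permEl (perm_sort _ _)).
have [s ts] := tuple_permP t_perm; exists s => a b le_ab.
have le_x_tr : transitive le_x by move=> u v w vu uw; apply: le_trans uw vu.
have t_sorted : sorted le_x t.
  by apply: sort_sorted => u v; apply: le_total.
have t_nth i : nth a t (val i) = s i.
  by rewrite ts -tnth_nth tnth_mktuple tnth_ord_tuple.
have t_size : size t = m by rewrite size_sort size_enum_ord.
rewrite -(t_nth a) -(t_nth b).
apply: (sorted_leq_nth le_x_tr (fun u => lexx _) a t_sorted) => //;
  by rewrite inE t_size; apply: ltn_ord.
Qed.

Lemma exists_notin (T : finType) (s : seq T) :
  (size s < #|T|)%N -> exists k, k \notin s.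
Proof.
move=> sT; apply/existsP; apply: contraTT sT => /existsPn s_full.
rewrite -leqNgt; apply: leq_trans (card_size s).
rewrite -(_ : #|s| = #|T|) //; apply: eq_card => k.
by have := s_full k; rewrite negbK.
Qed.

Lemma uniq_full (T : finType) (s : seq T) k :
  uniq s -> size s = #|T| -> k \in s.
Proof.
move=> s_uniq s_size; apply: contraT => ks.
have /card_uniqP ks_card : uniq (k :: s) by rewrite /= ks.
by have := max_card (mem (k :: s)); rewrite ks_card /= s_size ltnn.
Qed.

(** If some position [a < n] were sent outside [B], every element of [B] would occupy a position
    before [a], leaving fewer than n places for n elements. The order inside [B] and outside it is
    therefore irrelevant. *)
Lemma largest_entries (R : realType) (m n : nat) (x : 'I_m -> R)
    (B : {set 'I_m}) (s : {perm 'I_m}) :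
  #|B| = n -> (forall i j, i \in B -> j \notin B -> x j < x i) ->
  (forall a b : 'I_m, (a <= b)%N -> x (s b) <= x (s a)) ->
  [set s a | a : 'I_m & (a < n)%N]%SET = B.
Proof.
move=> Bn Bx s_dec.
have card_lt k : (k <= m)%N -> #|[set s a | a : 'I_m & (a < k)%N]%SET| = k.
  move=> km; rewrite card_imset; last exact: perm_inj.
  rewrite -sum1_card; transitivity (\sum_(a < m | (a < k)%N) 1)%N.
    by apply: eq_bigl => a; rewrite inE.
  by rewrite -(big_ord_widen _ (fun=> 1%N) km) sum1_card card_ord.
have nm : (n <= m)%N by rewrite -Bn -[m in (_ <= m)%N]card_ord max_card.
apply/eqP; rewrite eqEcard card_lt // Bn leqnn andbT.
apply/fintype.subsetP => _ /imsetP[a + ->]; rewrite inE => an.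
apply: contraTT an => saB; rewrite -leqNgt -Bn.
rewrite -[leqRHS]card_lt; last exact: ltnW.
apply/subset_leq_card/fintype.subsetP => i iB; apply/imsetP.
exists (s^-1%g i); last by rewrite permKV.
rewrite inE ltnNge; apply/negP => /s_dec; rewrite permKV leNgt.
by rewrite Bx.
Qed.

(** * The rounding algorithm *)

Section Rounding.
Variables (R : realType) (N K n : nat) (cl : 'I_N -> 'I_K).
Variable J : 'I_K -> {set 'I_N}.
Hypothesis n_gt0 : (0 < n)%N.
Hypothesis J_cl : forall i k, (i \in J k) = (cl i == k).
Hypothesis J_card : forall k, #|J k| = n.
Variables (D : 'M[R]_N) (c : R).
Hypothesis D_intra : forall i j, cl i = cl j -> D i j <= c.
Hypothesis D_inter : forall i j, cl i != cl j -> c < D i j.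

Section ActiveSet.
Variables (S : {set 'I_K}) (A : {set 'I_N}) (r : relaxation).
Hypothesis S_neq0 : S != finset.set0.
Hypothesis A_S : A = [set i | cl i \in S].

Let clA (a : 'I_#|A|) : 'I_K := cl (enum_val a).

Lemma active_clS a : clA a \in S.
Proof. by have := enum_valP a; rewrite {2}A_S inE. Qed.

Lemma active_image k :
  k \in S -> [set enum_val a | a : 'I_#|A| in [set a | clA a == k]]%SET = J k.
Proof.
move=> kS; apply/setP => i; rewrite J_cl; apply/imsetP/eqP => [[a + ->]|ik].
  by rewrite inE => /eqP.
have iA : i \in A by rewrite A_S inE ik.
exists (enum_rank_in iA i); last by rewrite enum_rankK_in.
by rewrite inE /clA enum_rankK_in // ik.
Qed.

Lemma active_card k : k \in S -> #|[set a | clA a == k]| = n.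
Proof.
move=> kS; rewrite -(J_card k) -(active_image kS) card_imset //.
exact: enum_val_inj.
Qed.

Lemma active_gt0 : (0 < #|A|)%N.
Proof.
case/set0Pn: S_neq0 => k kS.
have : (0 < #|J k|)%N by rewrite J_card.
case/card_gt0P => i; rewrite J_cl => /eqP ik.
by apply/card_gt0P; exists i; rewrite A_S inE ik.
Qed.

Lemma restr_intra a b : clA a = clA b -> restr D A a b <= c.
Proof. by rewrite mxE => /D_intra. Qed.

Lemma restr_inter a b : clA a != clA b -> c < restr D A a b.
Proof. by rewrite mxE => /D_inter. Qed.

Lemma Rb_solution_exists : exists z, @Rb_solution r R N n D A z.
Proof.
have [z zmin _] := Rb_minimizer_exists n_gt0 active_clS active_card
  restr_intra restr_inter active_gt0 r.
by exists z.
Qed.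

Lemma rounding_step_exists : exists I, rounding_step r n D A I.
Proof.
have [z zmin] := Rb_solution_exists.
have [s s_dec] := exists_decreasing_perm (fun a => z.1.1 a 0).
by eexists; exists z, s; split.
Qed.

(** In any optimal solution, x^1 is 1 on the cluster of the first active point and -1 on the others,
    so the n largest entries are that cluster however ties are sorted. *)
Lemma rounding_step_cluster I :
  rounding_step r n D A I -> exists2 k, k \in S & I = J k.
Proof.
case=> z [s [zmin s_dec ->]]; pose a0 := Ordinal active_gt0.
exists (clA a0); first exact: active_clS.
have xE a : z.1.1 a 0 = if clA a == clA a0 then 1 else -1.
  exact: (Rb_minimizer_x1 n_gt0 active_clS active_card restr_intra
    restr_inter active_gt0 a zmin).
rewrite -(active_image (active_clS a0)).
have top := @largest_entries R _ n (fun a => z.1.1 a 0) _ s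
  (active_card (active_clS a0)) _ s_dec.
rewrite -top; first by rewrite -imset_comp.
move=> a b; rewrite !inE !xE => -> /negPf->.
by rewrite -subr_gt0 opprK addr_gt0.
Qed.

End ActiveSet.

Lemma rounding_trace_le rel m p act I :
  (p <= m)%N -> rounding_trace rel n D m act I ->
  rounding_trace rel n D p act I.
Proof.
by move=> pm [act0 step]; split=> // k kp; apply: step; apply: leq_trans pm.
Qed.

(** This is the loop invariant: [s] lists the labels extracted so far, in order, and the active set
    is the union of the other clusters, so that the analysis of a single step applies again. *)
Lemma rounding_trace_clusters rel m act I :
  (m < K)%N -> rounding_trace rel n D m act I ->
  exists s : seq 'I_K,
    [/\ uniq s, size s = m, map J s = map I (iota 0 m)
      & act m = [set i | cl i \in [set k | k \notin s]]].
Proof.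
elim: m => [_ [act0 _]|m IH mK tr].
  by exists [::]; split=> //; rewrite act0; apply/setP => i; rewrite !inE.
have [s [s_uniq s_size s_map act_m]] :=
  IH (ltnW mK) (rounding_trace_le (leqnSn m) tr).
have S_neq0 : [set k | k \notin s]%SET != finset.set0.
  have [|k ks] := @exists_notin _ s; first by rewrite card_ord s_size ltnW.
  by apply/set0Pn; exists k; rewrite inE.
have [st act_m1] := tr.2 m (ltnSn m).
have [k kS Ik] := rounding_step_cluster S_neq0 act_m st.
move: kS; rewrite inE => ks; exists (rcons s k); split.
- by rewrite rcons_uniq ks.
- by rewrite size_rcons s_size.
- by rewrite map_rcons s_map -addn1 iotaD map_cat cats1 add0n Ik.
apply/setP => i; rewrite act_m1 act_m Ik !inE J_cl mem_rcons inE.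
by rewrite negb_or.
Qed.

Lemma rounding_active_step rel m act I :
  (m < K)%N -> rounding_trace rel n D m act I ->
  exists2 S : {set 'I_K}, S != finset.set0 & act m = [set i | cl i \in S].
Proof.
move=> mK tr; have [s [s_uniq s_size _ act_m]] := rounding_trace_clusters mK tr.
exists [set k | k \notin s]%SET => //.
have [|k ks] := @exists_notin _ s; first by rewrite card_ord s_size.
by apply/set0Pn; exists k; rewrite inE.
Qed.

Lemma rounding_trace_exists rel m :
  (m < K)%N -> exists act I, rounding_trace rel n D m act I.
Proof.
elim: m => [_|m IH mK].
  by exists (fun=> [set: 'I_N]%SET), (fun=> finset.set0); split.
have [act [I tr]] := IH (ltnW mK).
have [S S_neq0 act_m] := rounding_active_step (ltnW mK) tr.
have [Im st] := rounding_step_exists (rel m) S_neq0 act_m.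
(* Iteration [m] reads [act m] and produces [I m] and [act m.+1]; hence [act] is changed only after
   [m], but [I] from [m] on. *)
exists (fun k => if (k <= m)%N then act k else act m :\: Im).
exists (fun k => if (k < m)%N then I k else Im); split=> [|k].
  by rewrite leq0n; case: tr.
rewrite ltnS => km; rewrite km; case: (ltngtP k m) km => // [km|->] _.
  exact: tr.2.
by split.
Qed.

Lemma rounding_recovers_clusters rel :
  (0 < K)%N -> rounding_recovers rel n D J.
Proof.
move=> K_gt0; have predK : (K.-1 < K)%N by rewrite prednK.
split.
- move=> m act I mK tr.
  have [|S S_neq0 act_m] := rounding_active_step _ tr.
    by rewrite (leq_trans mK) // leq_pred.
  exact: Rb_solution_exists S_neq0 act_m.
- have [act [I tr]] := rounding_trace_exists rel predK.
  (* The last cluster is not extracted by a step: it is the set left after [K.-1] iterations. *)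
  pose I' k := if (k < K.-1)%N then I k else act K.-1.
  exists (fun k : 'I_K => I' k), act, I'; split=> //; last by rewrite /I' ltnn.
  by split=> [|k kK]; [case: tr | rewrite /I' kK; apply: tr.2].
move=> I [act [I' [tr I'last IE]]].
have [s [s_uniq s_size s_map act_last]] := rounding_trace_clusters predK tr.
(* After [K.-1] extractions exactly one label [k] is left, and it names the last cluster. *)
have [|k ks] := @exists_notin _ s; first by rewrite card_ord s_size.
have sk_uniq : uniq (rcons s k) by rewrite rcons_uniq ks.
have sk_size : size (rcons s k) = K by rewrite size_rcons s_size prednK.
have last_J : act K.-1 = J k.
  apply/setP => i; rewrite act_last !inE J_cl.
  apply/idP/eqP => [is_|->//].
  have : cl i \in rcons s k.
    by apply: uniq_full; rewrite ?sk_size ?card_ord.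
  by rewrite mem_rcons inE (negPf is_) orbF => /eqP.
(* The relabeling sends an iteration to the label extracted in it, with [k] for the last index;
   distinct labels make it injective. *)
pose f (a : 'I_K) := nth k (rcons s k) a.
have f_inj : injective f.
  move=> a b /eqP; rewrite /f nth_uniq ?sk_size // => /eqP; exact: val_inj.
exists (perm f_inj) => a; rewrite permE IE /f.
have sk_map : map J (rcons s k) = map I' (iota 0 K).
  rewrite map_rcons s_map -last_J -I'last -[in RHS](prednK K_gt0) -addn1 iotaD.
  by rewrite map_cat cats1 add0n.
rewrite -(nth_map _ finset.set0) ?sk_size // sk_map (nth_map 0%N) ?size_iota //.
by rewrite nth_iota.
Qed.

End Rounding.

(** * The separating threshold and the conclusion *)

(** The threshold is [max_intra D J]. It is not -oo because there is a point, and not +oo because it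
    is strictly below another value. Since [min_inter] only ranges over [k1 < k2], the other order
    of labels uses the symmetry of [D]. *)
Lemma separation_threshold (R : realType) (N K : nat) (D : 'M[R]_N)
    (J : 'I_K -> {set 'I_N}) (cl : 'I_N -> 'I_K) :
  (0 < N)%N -> (forall i k, (i \in J k) = (cl i == k)) ->
  (forall i j, D i j = D j i) -> (max_intra D J < min_inter D J)%E ->
  exists c : R, (forall i j, cl i = cl j -> D i j <= c) /\
                (forall i j, cl i != cl j -> c < D i j).
Proof.
move=> N_gt0 J_cl D_sym sep.
have intra i j : cl i = cl j -> ((D i j)%:E <= max_intra D J)%E.
  move=> ij; apply: (bigmax_sup (cl i)) => //.
  apply: (bigmax_sup i); rewrite ?J_cl //.
  by apply: (bigmax_sup j); rewrite ?J_cl ?ij.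
have inter_lt i j : (cl i < cl j)%N -> (min_inter D J <= (D i j)%:E)%E.
  move=> ij; apply: (bigmin_inf (cl i)) => //; apply: (bigmin_inf (cl j)) => //.
  apply: (bigmin_inf i); rewrite ?J_cl //.
  by apply: (bigmin_inf j); rewrite ?J_cl.
have inter i j : cl i != cl j -> (min_inter D J <= (D i j)%:E)%E.
  rewrite -(inj_eq val_inj) neq_ltn => /orP[/inter_lt //|/inter_lt].
  by rewrite D_sym.
have := intra (Ordinal N_gt0) _ erefl.
move: sep intra; case: (max_intra D J) => [c||_ _ //]; last first.
  by rewrite ltNge leey.
move=> sep intra _; exists c; split=> i j ij; first by rewrite -lee_fin intra.
by rewrite -lte_fin; apply: lt_le_trans sep (inter i j ij).
Qed.

Theorem theorem3 (R : realType) (d N K n : nat) (xi : 'I_N -> 'rV[R]_d)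
    (hK : (0 < K)%N) (hn : (0 < n)%N) (hN : N = (K * n)%N)
    (J : 'I_K -> {set 'I_N})
    (hJpart : is_partition J)
    (hJcard : forall k, #|J k| = n)
    (hsep : (max_intra (sqdist xi) J < min_inter (sqdist xi) J)%E) :
  [/\ opt_value (@Rb_feasible LP R N n) (Rb_obj n (sqdist xi))
        = opt_value (@P_feasible R N K (fun=> n)) (P_obj (fun=> n) (sqdist xi)),
      minimizer (@P_feasible R N K (fun=> n)) (P_obj (fun=> n) (sqdist xi))
        (clustering_point R J)
    & forall rel : nat -> relaxation, rounding_recovers rel n (sqdist xi) J].
Proof.
have N_gt0 : (0 < N)%N by rewrite hN muln_gt0 hK.
(* The covering property yields a label map [cl], and disjointness identifies its fibers with the
   clusters. *)
have [/choice[cl clP] J_disj] := hJpart.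
have J_cl i k : (i \in J k) = (cl i == k).
  case: eqVneq => [<-|ik]; first exact: clP.
  exact: (disjointFr (J_disj _ _ ik) (clP i)).
have D_ge0 i j : 0 <= sqdist xi i j by rewrite mxE sqr_ge0.
have D_sym i j : sqdist xi i j = sqdist xi j i.
  rewrite !mxE /enorm; congr (Num.sqrt _ ^+ 2); apply: eq_bigr => l _.
  by rewrite !mxE -sqrrN opprB.
have [c [D_intra D_inter]] := separation_threshold N_gt0 J_cl D_sym hsep.
have P_min := clustering_point_minimizer hn J_cl hJcard D_ge0 D_intra D_inter.
have [z z_min z_opt] := Rb_minimizer_exists hn (S := [set: 'I_K]%SET)
  (fun i => finset.in_setT (cl i)) (fun k _ => card_fiber J_cl hJcard k)
  D_intra D_inter N_gt0 LP.
split=> // [|rel].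
  rewrite (opt_value_minimizer z_min) (opt_value_minimizer P_min) z_opt.
  by rewrite (clustering_point_obj _ J_cl).
exact: (rounding_recovers_clusters hn J_cl hJcard D_intra D_inter).
Qed.
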